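(* Let the infinite cyclic group $\mathbb{Z}$ be given by the presentation $\mathbb{Z}=\langle t_1,\ldots,t_{n+1}\mid t_1=\cdots=t_{n+1}\rangle$, with generators $t_1,\ldots,t_{n+1}$, and let $H=\langle h_1,\ldots,h_n\rangle<\mathrm{Homeo}^+(I)$ be an $n$-generated group. Then there exists a square root $G$ of $\mathbb{Z}$ (with respect to the generators $t_1,\dots,t_{n+1}$) such that $\widehat{H}<G$, i.e. the skew subdirect product $\widehat H$ of $H$ (with respect to $h_1,\dots,h_n$) is isomorphic to a subgroup of $G$.
   Context: $I=[0,1]$ and $\mathrm{Homeo}^+(I)$ is the group of orientation-preserving homeomorphisms of $I$. For a finitely generated group $K=\langle k_1,\ldots,k_m\rangle$ with a chosen generating tuple, a square root of $K$ is an $m$-generated subgroup $G=\langle g_1,\ldots,g_m\rangle<\mathrm{Homeo}^+(I)$ such that $K\cong\langle g_1^2,\ldots,g_m^2\rangle$. The notion depends on the chosen generators of $K$ (it is a square root of a marked group): the isomorphism is taken to send $k_i$ to $g_i^2$. For a group $H=\langle h_1,\ldots,h_n\rangle$ with a chosen generating tuple, the skew subdirect product $\widehat{H}$ is the subgroup of $H\times H$ generated by $\{(h_i,h_i^{-1})\}_{i=1}^n$. *)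

(* Defs.v *)
From HB Require Import structures.
From mathcomp Require Import all_boot all_order all_algebra.
From mathcomp Require Import all_classical all_reals all_analysis.
Import numFieldNormedType.Exports.
Import Order.TTheory GRing.Theory Num.Theory.

Set Implicit Arguments.
Unset Strict Implicit.
Unset Printing Implicit Defensive.

Local Open Scope classical_set_scope.
Local Open Scope group_scope.

(* [set_type] carries the topology induced from [R]. *)
Definition unit_itv (R : realType) : Type := set_type (`[0%R, 1%R] : set R).
HB.instance Definition _ (R : realType) := Topological.on (unit_itv R).

(* A homeomorphism of a compact interval preserves the orientation iff it is
   strictly increasing. *)
Record homeo (R : realType) := Homeo {
  homeo_fun :> unit_itv R -> unit_itv R ;
  homeo_inv : unit_itv R -> unit_itv R ;
  homeo_funK : cancel homeo_fun homeo_inv ;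
  homeo_invK : cancel homeo_inv homeo_fun ;
  homeo_fun_continuous : continuous homeo_fun ;
  homeo_inv_continuous : continuous homeo_inv ;
  homeo_fun_increasing :
    {homo homeo_fun : x y / (set_val x < set_val y :> R)%R} }.

Lemma homeo_ext (R : realType) (f g : homeo R) :
  (forall x, f x = g x) -> f = g.
Proof.
case: f => f f' fK f'K cf cf' mf; case: g => g g' gK g'K cg cg' mg /= /funext fg.
subst g.
have /funext ff' : forall x, f' x = g' x by move=> x; rewrite -{1}(g'K x) fK.
by subst g'; congr Homeo; exact: Prop_irrelevance.
Qed.

Section HomeoGroup.
Variable R : realType.
Implicit Types f g : homeo R.

Definition homeo1 : homeo R.
Proof. by exists id id => // x; exact: cvg_id. Defined.

Definition homeoM f g : homeo R.
Proof.
exists (f \o g) (homeo_inv g \o homeo_inv f).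
- by move=> x /=; rewrite !homeo_funK.
- by move=> x /=; rewrite !homeo_invK.
- by move=> x; apply: continuous_comp; exact: homeo_fun_continuous.
- by move=> x; apply: continuous_comp; exact: homeo_inv_continuous.
- by move=> x y /= xy; do 2 apply: homeo_fun_increasing.
Defined.

Lemma homeo_inv_increasing f :
  {homo homeo_inv f : x y / (set_val x < set_val y :> R)%R}.
Proof.
move=> x y xy; rewrite ltNge le_eqVlt; apply/negP => /orP[/eqP e|].
  have e' : homeo_inv f y = homeo_inv f x by exact/val_inj.
  by move: xy; rewrite -(homeo_invK f x) -(homeo_invK f y) e' ltxx.
by move=> /(homeo_fun_increasing f); rewrite !homeo_invK ltNge (ltW xy).
Qed.

Definition homeoV f : homeo R.
Proof.
exists (homeo_inv f) f.
- exact: homeo_invK.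
- exact: homeo_funK.
- exact: homeo_inv_continuous.
- exact: homeo_fun_continuous.
- exact: homeo_inv_increasing.
Defined.

HB.instance Definition _ := gen_eqMixin (homeo R).
HB.instance Definition _ := gen_choiceMixin (homeo R).

Lemma homeoA : associative homeoM. Proof. by move=> f g h; exact: homeo_ext. Qed.
Lemma homeo1M : left_id homeo1 homeoM. Proof. by move=> f; exact: homeo_ext. Qed.
Lemma homeoM1 : right_id homeo1 homeoM. Proof. by move=> f; exact: homeo_ext. Qed.
Lemma homeoVM : left_inverse homeo1 homeoV homeoM.
Proof. by move=> f; apply: homeo_ext => x /=; rewrite homeo_funK. Qed.
Lemma homeoMV : right_inverse homeo1 homeoV homeoM.
Proof. by move=> f; apply: homeo_ext => x /=; rewrite homeo_invK. Qed.

HB.instance Definition _ :=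
  isGroup.Build (homeo R) homeoA homeo1M homeoM1 homeoVM homeoMV.

End HomeoGroup.

Definition subgroup (T : groupType) (A : set T) : Prop := group_closed (mem A).

Definition gen (T : groupType) (S : set T) : set T :=
  smallest (@subgroup T) S.

Definition group_iso (S T : groupType) (A : set S) (B : set T) (f : S -> T) :
    Prop :=
  set_bij A B f /\ {in A &, {morph f : x y / x * y}}.

Definition isomorphic (S T : groupType) (A : set S) (B : set T) : Prop :=
  exists f : S -> T, group_iso A B f.

Definition marked_isomorphic (S T : groupType) (m : nat)
    (s : 'I_m -> S) (t : 'I_m -> T) : Prop :=
  exists2 f : S -> T,
    group_iso (gen (range s)) (gen (range t)) f & forall i, f (s i) = t i.

Section Presentation.
Variable m : nat.

(* [(i, false)] is the i-th letter and [(i, true)] its formal inverse. *)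
Definition word := seq ('I_m * bool).

Definition word_eval (K : groupType) (k : 'I_m -> K) (w : word) : K :=
  \prod_(a <- w) (if a.2 then (k a.1)^-1 else k a.1).

(* Two words are related iff they are equal in < x_0, .., x_(m-1) | rel >. *)
Inductive word_equiv (rel : word -> word -> Prop) : word -> word -> Prop :=
| word_equiv_refl u : word_equiv rel u u
| word_equiv_sym u v : word_equiv rel u v -> word_equiv rel v u
| word_equiv_trans u v w :
    word_equiv rel u v -> word_equiv rel v w -> word_equiv rel u w
| word_equiv_cat u u' v v' :
    word_equiv rel u u' -> word_equiv rel v v' ->
    word_equiv rel (u ++ v) (u' ++ v')
| word_equiv_cancel i b : word_equiv rel [:: (i, b); (i, ~~ b)] [::]
| word_equiv_rel u v : rel u v -> word_equiv rel u v.

Definition presented_by (K : groupType) (k : 'I_m -> K)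
    (rel : word -> word -> Prop) : Prop :=
  gen (range k) = setT /\
  forall u v, word_eval k u = word_eval k v <-> word_equiv rel u v.

(* All the relations x_i = x_j. *)
Definition equal_generators (u v : word) : Prop :=
  exists i j : 'I_m, u = [:: (i, false)] /\ v = [:: (j, false)].

End Presentation.

Lemma int_presented_by (n : nat) :
  presented_by (fun _ : 'I_n.+1 => 1%R : Algebra.to_multiplicative int)
    (@equal_generators n.+1).
Proof.
set t := (t in presented_by t _); set eqv := word_equiv (@equal_generators n.+1).
have evalE b w : word_eval t (b :: w) =
    ((if b.2 then -1 else 1) + word_eval t w)%R.
  by rewrite /word_eval big_cons.
have eval_cat u v : word_eval t (u ++ v) = (word_eval t u + word_eval t v)%R.
  by rewrite /word_eval big_cat.
split.
  rewrite -subTset => z _ A [[A1 AV] tA].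
  have A1' : 1%g \in A := A1.
  have AM : {in mem A &, forall x y, x * y \in mem A} := group_closedM (conj A1 AV).
  have Ai : {in mem A, forall x, x^-1 \in mem A} := group_closedV (conj A1 AV).
  have At : (1%R : Algebra.to_multiplicative int) \in mem A.
    by apply/mem_set/tA; exists ord0.
  have Ak (k : nat) : ((k : int) : Algebra.to_multiplicative int) \in mem A.
    elim: k => [//|k IH]; rewrite intS.
    exact: (AM (1%R : Algebra.to_multiplicative int) (k : int)).
  have : z \in mem A; last by move/set_mem.
  case: z => k; first exact: Ak.
  by rewrite NegzE; exact: Ai (Ak k.+1).
have trans u v w : eqv u v -> eqv v w -> eqv u w by exact: word_equiv_trans.
have catl u v w : eqv v w -> eqv (u ++ v) (u ++ w).
  by apply: word_equiv_cat; exact: word_equiv_refl.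
have catr u v w : eqv v w -> eqv (v ++ u) (w ++ u).
  by move=> vw; apply: word_equiv_cat => //; exact: word_equiv_refl.
have letter i b : eqv [:: (i, b)] [:: (ord0, b)].
  case: b; last by apply: word_equiv_rel; exists i, ord0.
  apply: (trans _ ([:: (i, true)] ++ [:: (ord0, false); (ord0, true)])).
    by apply: word_equiv_sym; apply: (catl [:: _] _ [::]);
       exact: (word_equiv_cancel _ ord0 false).
  apply: (trans _ ([:: (i, true); (i, false)] ++ [:: (ord0, true)])).
    apply: (catl [:: (i, true)] [:: (ord0, false); (ord0, true)]
                 [:: (i, false); (ord0, true)]).
    apply: (catr [:: (ord0, true)] [:: (ord0, false)] [:: (i, false)]).
    by apply: word_equiv_rel; exists ord0, i.
  exact: (catr _ _ [::] (word_equiv_cancel _ i true)).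
pose nf (z : int) : word n.+1 := match z with
  | Posz k => nseq k (ord0, false) | Negz k => nseq k.+1 (ord0, true) end.
have nfS b z : eqv ((ord0, b) :: nf z) (nf ((if b then -1 else 1) + z)%R).
  case: b z => -[[|k]|k]; try exact: word_equiv_refl.
    rewrite intS addrA addNr add0r.
    exact: (catr _ _ [::] (word_equiv_cancel _ ord0 true)).
  rewrite (_ : nf (1 + _)%R = nseq k (ord0, true)).
    exact: (catr _ _ [::] (word_equiv_cancel _ ord0 false)).
  by rewrite NegzE intS opprD addrA subrr add0r; case: k.
have nfP w : eqv w (nf (word_eval t w)).
  elim: w => [|[i b] w IH].
    by rewrite /word_eval big_nil; exact: word_equiv_refl.
  rewrite evalE; apply: trans (nfS b _).
  exact: (word_equiv_cat (letter i b) IH).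
move=> u v; split=> [uv|].
  by apply: trans (nfP u) _; rewrite uv; apply: word_equiv_sym; exact: nfP.
elim=> //.
- by move=> ? ? ? _ -> _ ->.
- by move=> ? ? ? ? _ e1 _ e2; rewrite !eval_cat e1 e2.
- by move=> i [] /=; rewrite !evalE /= /word_eval big_nil.
- by move=> _ _ [i [j [-> ->]]]; rewrite !evalE.
Qed.

Definition square_root (R : realType) (K : groupType) (m : nat)
    (k : 'I_m -> K) (G : set (homeo R)) : Prop :=
  exists2 g : 'I_m -> homeo R,
    G = gen (range g) & marked_isomorphic k (fun i => g i ^+ 2).

Definition skew_subdirect (T : groupType) (n : nat) (h : 'I_n -> T) :
    set (T * T) :=
  gen (range (fun i => (h i, (h i)^-1))).

(* Main.v *)
(* Identify the interior of [I] with the real line.  Let [tau] be the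
   translation by 1, and for homeomorphisms [f], [g] of [I] let
   [alternating (f, g)] act as [f] on the cells [[k, k + 1]] with [k] even and
   as [g] on those with [k] odd.  This is a faithful action of the product, and
   conjugation by [tau] exchanges the two factors.  Hence [tau] and all the
   [tau * alternating (h_i, h_i^-1)] have the same square, the translation by 2,
   which has infinite order; and the group they generate contains every
   [alternating (h_i, h_i^-1)], that is, a copy of the skew subdirect product. *)
Require Import Defs.
From mathcomp Require Import all_boot all_order all_algebra.
From mathcomp Require Import all_classical all_reals all_analysis.
From mathcomp Require Import ring zify.
Import numFieldNormedType.Exports.
Import Order.TTheory GRing.Theory Num.Theory.
Local Open Scope classical_set_scope.

(** * Generated subgroups, words and marked isomorphisms *)

Section Groups.
Local Set Implicit Arguments.
Local Unset Strict Implicit.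
Local Open Scope group_scope.

Lemma subgroup_gen {T : groupType} (S : set T) : subgroup (gen S).
Proof.
split=> [|x y /set_mem Sx /set_mem Sy]; apply/mem_set => A [sA SA].
  by case: sA => /set_mem.
by case: (sA) => _ /(_ x y) H; apply/set_mem/H; apply/mem_set; [exact: Sx|exact: Sy].
Qed.

Lemma sub_gen {T : groupType} (S : set T) : S `<=` gen S.
Proof. exact: sub_gen_smallest. Qed.

Lemma gen_subP {T : groupType} (S A : set T) :
  subgroup A -> S `<=` A -> gen S `<=` A.
Proof. exact: smallest_sub. Qed.

Lemma morphV {S T : groupType} (f : S -> T) :
  {morph f : x y / x * y} -> {morph f : x / x^-1}.
Proof.
move=> fM x; apply: (mulgI (f x)); rewrite -fM !mulgV.
by apply: (mulgI (f 1)); rewrite -fM !mulg1.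
Qed.

Lemma morph_div {S T : groupType} (f : S -> T) :
  {morph f : x y / x * y} -> forall x y, f (x * y^-1) = f x * (f y)^-1.
Proof. by move=> fM x y; rewrite fM morphV. Qed.

Lemma morph1 {S T : groupType} (f : S -> T) :
  {morph f : x y / x * y} -> f 1 = 1.
Proof. by move=> fM; apply: (mulgI (f 1)); rewrite -fM !mulg1. Qed.

Lemma subgroup_preimage {S T : groupType} (f : S -> T) (A : set T) :
  {morph f : x y / x * y} -> subgroup A -> subgroup (f @^-1` A).
Proof.
move=> fM [A1 AV]; split=> [|x y /set_mem Ax /set_mem Ay]; apply/mem_set.
  by rewrite /preimage /= (morph1 fM); apply/set_mem.
by rewrite /preimage /= (morph_div fM); apply/set_mem/AV; apply/mem_set.
Qed.

Lemma subgroup_image {S T : groupType} (f : S -> T) (A : set S) :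
  {morph f : x y / x * y} -> subgroup A -> subgroup (f @` A).
Proof.
move=> fM [A1 AV]; split=> [|_ _ /set_mem[x Ax <-] /set_mem[y Ay <-]]; apply/mem_set.
  by exists 1; [apply/set_mem|rewrite (morph1 fM)].
exists (x * y^-1); last by rewrite (morph_div fM).
by apply/set_mem/AV; apply/mem_set.
Qed.

Lemma word_eval_cat {m : nat} {T : groupType} (k : 'I_m -> T) (u v : word m) :
  word_eval k (u ++ v) = word_eval k u * word_eval k v.
Proof. by rewrite /word_eval big_cat. Qed.

(** Values of words already form a subgroup. This lets maps out of a generated subgroup be defined
    through representing words. *)
Lemma gen_range {m : nat} {T : groupType} (k : 'I_m -> T) :
  gen (range k) = range (word_eval k).
Proof.
apply/seteqP; split=> [|_ [w _ <-]].
  apply: gen_subP => [|_ [i _ <-]]; last first.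
    by exists [:: (i, false)] => //; rewrite /word_eval big_seq1.
  split=> [|_ _ /set_mem[u _ <-] /set_mem[v _ <-]]; apply/mem_set.
    by exists [::] => //; rewrite /word_eval big_nil.
  (* Reversing [v] and flipping every sign spells the inverse of its value. *)
  exists (u ++ rev [seq (a.1, ~~ a.2) | a <- v]) => //.
  rewrite word_eval_cat; congr (_ * _).
  elim: v => [|[i b] v IH] /=; first by rewrite /word_eval big_nil invg1.
  rewrite rev_cons -cats1 word_eval_cat IH /word_eval big_seq1 big_cons /= invgM.
  by case: b => //=; rewrite invgK.
have S := subgroup_gen (range k).
apply/set_mem; rewrite /word_eval.
apply: (big_ind (fun x => x \in gen (range k))) => [|x y Sx Sy|[i b] _].
- by case: S.
- exact: (group_closedM S).
have Sk : k i \in mem (gen (range k)) by apply/mem_set; apply: sub_gen; exists i.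
by case: b => //=; exact: (group_closedV S).
Qed.

(** The isomorphism spells an element in the letters [s] and rereads the word in the letters [t].
    The implication from left to right makes it well defined, the converse makes it injective. *)
Lemma marked_isomorphic_words {S T : groupType} {m : nat}
    (s : 'I_m -> S) (t : 'I_m -> T) :
  (forall u v, word_eval s u = word_eval s v <-> word_eval t u = word_eval t v) ->
  marked_isomorphic s t.
Proof.
move=> st.
(* Elements outside the generated subgroup receive the empty word as a dummy value. *)
have /choice[w wE] : forall x, exists w : word m,
    range (word_eval s) x -> word_eval s w = x.
  move=> x; have [[w _ wx]|nx] := pselect (range (word_eval s) x).
    by exists w.
  by exists [::].
have wK u : word_eval t (w (word_eval s u)) = word_eval t u.
  by apply/st/wE; exists u.
exists (word_eval t \o w).
  rewrite /group_iso !gen_range; split; first split.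
  - by move=> _ [u _ <-] /=; rewrite wK; exists u.
  - move=> _ _ /set_mem[u _ <-] /set_mem[v _ <-] /=.
    by rewrite !wK => /st.
  - by move=> _ [u _ <-]; exists (word_eval s u); [exists u|rewrite /= wK].
  move=> _ _ /set_mem[u _ <-] /set_mem[v _ <-] /=.
  by rewrite -word_eval_cat !wK word_eval_cat.
move=> i /=; have := wK [:: (i, false)].
by rewrite /word_eval !big_seq1.
Qed.

End Groups.

(** * Homeomorphisms obtained from increasing bijections of the interval *)

Section Homeos.
Local Set Implicit Arguments.
Local Unset Strict Implicit.
Context {R : realType}.
Local Open Scope ring_scope.
Implicit Types x y : unit_itv R.

Lemma unit_itv_ge0 x : 0 <= set_val x.
Proof. by have := set_valP x; rewrite set_valE /= in_itv /= => /andP[]. Qed.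

Lemma unit_itv_le1 x : set_val x <= 1.
Proof. by have := set_valP x; rewrite set_valE /= in_itv /= => /andP[]. Qed.

Lemma unit_proj_subproof (r : R) : Num.max 0 (Num.min r 1) \in `[0, 1]%classic.
Proof.
by apply/mem_set; rewrite /= in_itv /= le_max lexx ge_max ler01 ge_min lexx orbT.
Qed.

(** Clamping makes this total; it is meaningful on [[0, 1]] only, where [unit_projK] applies. *)
Definition unit_proj (r : R) : unit_itv R :=
  @exist R (fun s => s \in `[0, 1]%classic) _ (unit_proj_subproof r).

Lemma unit_projK (r : R) : 0 <= r <= 1 -> set_val (unit_proj r) = r.
Proof. by case/andP=> r0 r1; rewrite set_valE /= min_l// max_r. Qed.

Lemma set_valK x : unit_proj (set_val x) = x.
Proof. by apply/val_inj/unit_projK; rewrite unit_itv_ge0 unit_itv_le1. Qed.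

(** Stated for bare functions, since it serves to build elements of [homeo R]. *)
Lemma homo_inv_lt (f f' : unit_itv R -> unit_itv R) : cancel f' f ->
  {homo f : x y / set_val x < set_val y} ->
  {homo f' : x y / set_val x < set_val y}.
Proof.
move=> f'K fi x y xy; rewrite ltNge le_eqVlt; apply/negP => /orP[/eqP e|].
  have e' : f' y = f' x by exact/val_inj.
  by move: xy; rewrite -(f'K x) -(f'K y) e' ltxx.
by move=> /fi; rewrite !f'K ltNge (ltW xy).
Qed.

(** The preimages of [f x - e] and [f x + e] bracket [x], and every point between them has its image
    within [e] of [f x]. *)
Lemma increasing_continuous (f f' : unit_itv R -> unit_itv R) :
  cancel f f' -> cancel f' f ->
  {homo f : x y / set_val x < set_val y} -> continuous f.
Proof.
move=> fK f'K fi; have f'i := homo_inv_lt f'K fi.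
suff cf : continuous (set_val \o f : unit_itv R -> R).
  exact: continuous_comp_initial.
move=> x.
have vc : {for x, continuous (set_val : unit_itv R -> R)}.
  exact: initial_continuous.
have FF : Filter (nbhs x) by exact: nbhs_filter.
apply/(@cvgrPdist_lt _ _ _ (nbhs x) FF) => e e0.
have [B1 B2] : (\forall y \near x, set_val (f x) - e < set_val (f y)) /\
               (\forall y \near x, set_val (f y) < set_val (f x) + e).
  split.
    (* When [f x - e] falls below 0 it has no preimage, but the bound is then automatic; the upper
       bound is split at 1 likewise. *)
    have [h|h] := ltP (set_val (f x) - e) 0.
      by near=> y; apply: lt_le_trans h (unit_itv_ge0 _).
    have pK : set_val (unit_proj (set_val (f x) - e)) = set_val (f x) - e.
      by rewrite unit_projK// h /= lerBlDr (le_trans (unit_itv_le1 _))// lerDl ltW.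
    have px : set_val (f' (unit_proj (set_val (f x) - e))) < set_val x.
      by rewrite -[x in _ < set_val x]fK; apply: f'i; rewrite pK ltrBlDr ltrDl.
    have : \forall y \near x, set_val (f' (unit_proj (set_val (f x) - e))) < set_val y.
      exact: (vc _ (lt_nbhsr px)).
    by apply: filterS => y /fi; rewrite f'K pK.
  have [h|h] := ltP 1 (set_val (f x) + e).
    by near=> y; apply: le_lt_trans (unit_itv_le1 _) h.
  have pK : set_val (unit_proj (set_val (f x) + e)) = set_val (f x) + e.
    by rewrite unit_projK// h addr_ge0 ?unit_itv_ge0// ltW.
  have px : set_val x < set_val (f' (unit_proj (set_val (f x) + e))).
    by rewrite -[x in set_val x < _]fK; apply: f'i; rewrite pK ltrDl.
  have : \forall y \near x, set_val y < set_val (f' (unit_proj (set_val (f x) + e))).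
    exact: (vc _ (lt_nbhsl px)).
  by apply: filterS => y /fi; rewrite f'K pK.
near=> y; rewrite ltr_distlC.
by apply/andP; split; near: y.
Unshelve. all: by end_near. Qed.

Definition increasing_homeo {f f' : unit_itv R -> unit_itv R}
    (fK : cancel f f') (f'K : cancel f' f)
    (fi : {homo f : x y / set_val x < set_val y}) : homeo R :=
  Homeo fK f'K (increasing_continuous fK f'K fi)
    (increasing_continuous f'K fK (homo_inv_lt f'K fi)) fi.

(** * The logistic order isomorphism from the line onto the open interval *)

Definition logistic (r : R) : R := expR r / (1 + expR r).

Definition logit (r : R) : R := ln (r / (1 - r)).

Lemma logistic_itv r : 0 < logistic r < 1.
Proof.
have e0 := expR_gt0 r; have e1 : 0 < 1 + expR r by rewrite addr_gt0.
by rewrite divr_gt0//= ltr_pdivrMr// mul1r ltrDr.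
Qed.

Lemma logisticK : cancel logistic logit.
Proof.
move=> r; rewrite /logit /logistic; have e0 := expR_gt0 r.
rewrite -[RHS]expRK; congr ln; field.
by rewrite addrK oner_neq0 /= gt_eqF// addr_gt0.
Qed.

Lemma logitK r : 0 < r < 1 -> logistic (logit r) = r.
Proof.
case/andP=> r0 r1; rewrite /logit /logistic lnK; last first.
  by rewrite posrE divr_gt0 ?subr_gt0.
have r1' : 1 - r != 0 by rewrite subr_eq0 gt_eqF.
by field; rewrite r1' subrK oner_neq0.
Qed.

Lemma logistic_lt : {mono logistic : r s / r < s}.
Proof.
apply: leW_mono; apply: le_mono => r s rs; rewrite /logistic.
have er := expR_gt0 r; have es := expR_gt0 s.
rewrite ltr_pdivrMr ?addr_gt0// mulrAC ltr_pdivlMr ?addr_gt0//.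
(* Once denominators are cleared, both sides share the term [expR r * expR s]. *)
by rewrite !mulrDr !mulr1 [expR s * _]mulrC ltrD2r ltr_expR.
Qed.

Lemma logit_lt r s : 0 < r < 1 -> 0 < s < 1 -> r < s -> logit r < logit s.
Proof. by move=> r01 s01; rewrite -logistic_lt !logitK. Qed.

(** Conjugate of [f] by the logistic map, completed by fixing both endpoints. *)
Definition extend (f : R -> R) x : unit_itv R :=
  if 0 < set_val x < 1 then unit_proj (logistic (f (logit (set_val x)))) else x.

Lemma val_extend f x : set_val (extend f x) =
  if 0 < set_val x < 1 then logistic (f (logit (set_val x))) else set_val x.
Proof.
rewrite /extend; case: ifP => // _; apply: unit_projK.
by have /andP[a b] := logistic_itv (f (logit (set_val x))); rewrite !ltW.
Qed.

Lemma extend_comp f g x : extend f (extend g x) = extend (f \o g) x.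
Proof.
apply: val_inj; rewrite -[val]set_valE !val_extend.
by have [x01|/negPf x01] := boolP (0 < set_val x < 1);
  rewrite ?x01// logistic_itv logisticK.
Qed.

Lemma extend_logistic f r :
  set_val (extend f (unit_proj (logistic r))) = logistic (f r).
Proof.
have r01 := logistic_itv r.
have rK : set_val (unit_proj (logistic r)) = logistic r.
  by apply: unit_projK; case/andP: r01 => a b; rewrite !ltW.
by rewrite val_extend rK r01 logisticK.
Qed.

Lemma extendK f f' : cancel f f' -> cancel (extend f) (extend f').
Proof.
move=> fK x; rewrite extend_comp; apply: val_inj; rewrite -[val]set_valE.
by rewrite val_extend; case: ifP => // x01; rewrite /= fK logitK.
Qed.

Lemma extend_homo_lt f : {homo f : r s / r < s} ->
  {homo extend f : x y / set_val x < set_val y}.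
Proof.
move=> fi x y xy; rewrite !val_extend.
have x0 := unit_itv_ge0 x; have y1 := unit_itv_le1 y.
have /andP[lx0 lx1] := logistic_itv (f (logit (set_val x))).
have /andP[ly0 ly1] := logistic_itv (f (logit (set_val y))).
case: ifPn => [x01|x01]; case: ifPn => [y01|y01].
- by rewrite logistic_lt; apply/fi/logit_lt.
- apply: lt_le_trans lx1 _; move: y01; rewrite negb_and -!leNgt => /orP[|//].
  by rewrite leNgt (le_lt_trans x0 xy).
- apply: le_lt_trans ly0; move: x01; rewrite negb_and -!leNgt => /orP[//|].
  by rewrite leNgt (lt_le_trans xy y1).
- by [].
Qed.

Definition line_homeo (f f' : R -> R) (fK : cancel f f') (f'K : cancel f' f)
    (fi : {homo f : r s / r < s}) : homeo R :=
  increasing_homeo (extendK fK) (extendK f'K) (extend_homo_lt fi).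

Lemma extend_inj (f g : R -> R) : extend f =1 extend g -> f =1 g.
Proof.
move=> fg r; apply: (can_inj logisticK).
by rewrite -!extend_logistic fg.
Qed.

(** * Maps of the line acting separately on each unit cell *)

Lemma homeo_lt1 (f : homeo R) x : set_val x < 1 -> set_val (f x) < 1.
Proof.
have e1 : set_val (unit_proj 1) = 1 :> R by rewrite unit_projK// ler01 lexx.
rewrite -[X in _ < X -> _]e1 => /(homeo_fun_increasing f) fx.
exact: lt_le_trans fx (unit_itv_le1 _).
Qed.

Lemma homeo_fix1 (f : homeo R) x : set_val x = 1 -> f x = x.
Proof.
(* A preimage of 1 lying below 1 would contradict [homeo_lt1], so the inverse already fixes 1. *)
move=> x1; have [y1|y1] := ltP (set_val (homeoV f x)) 1.
  by have := homeo_lt1 f y1; rewrite /= homeo_invK x1 ltxx.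
have e : homeo_inv f x = x.
  by apply: val_inj; rewrite -[val]set_valE x1; apply: le_anti; rewrite y1 unit_itv_le1.
by rewrite -[in LHS]e homeo_invK.
Qed.

(** The floor selects the half-open cell [[k, k + 1)], on which a copy of [p k] acts. *)
Definition cellwise (p : int -> homeo R) (r : R) : R :=
  (Num.floor r)%:~R
  + set_val (p (Num.floor r) (unit_proj (r - (Num.floor r)%:~R))).

Lemma floor_shift (k : int) x : set_val x < 1 ->
  Num.floor (k%:~R + set_val x) = k.
Proof.
by move=> x1; apply: floor_def; rewrite lerDl unit_itv_ge0 intrD ltrD2l.
Qed.

Lemma cellwise_shift p (k : int) x : set_val x < 1 ->
  cellwise p (k%:~R + set_val x) = k%:~R + set_val (p k x).
Proof. by move=> x1; rewrite /cellwise floor_shift// addrAC subrr add0r set_valK. Qed.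

Variant floor_frac_spec (r : R) : Type :=
  FloorFrac k x of set_val x < 1 & r = k%:~R + set_val x.

Lemma floor_fracP r : floor_frac_spec r.
Proof.
have /andP[r0 r1] := floor_itv r; rewrite intrD in r1.
have e : set_val (unit_proj (r - (Num.floor r)%:~R)) = r - (Num.floor r)%:~R.
  by rewrite unit_projK// subr_ge0 r0 lerBlDl ltW.
exists (Num.floor r) (unit_proj (r - (Num.floor r)%:~R)); rewrite e.
  by rewrite ltrBlDl.
by rewrite addrC subrK.
Qed.

(** By [homeo_lt1] the inner map keeps each half-open cell, so both stages see the same floor. *)
Lemma cellwise_comp p q r :
  cellwise p (cellwise q r) = cellwise (fun k => p k * q k)%g r.
Proof. by have [k x x1 ->] := floor_fracP r; rewrite !cellwise_shift// homeo_lt1. Qed.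

Lemma cellwise1 r : cellwise (fun=> 1%g) r = r.
Proof. by have [k x x1 ->] := floor_fracP r; rewrite cellwise_shift. Qed.

(** Inside one cell this is monotonicity of [p k]; images in different cells are separated by an
    integer. *)
Lemma cellwise_lt p : {homo cellwise p : r s / r < s}.
Proof.
move=> r s; have [k x x1 ->] := floor_fracP r; have [l y y1 ->] := floor_fracP s.
rewrite !cellwise_shift//; have [kl|lk|->] := ltgtP k l; last first.
- by rewrite !ltrD2l; exact: homeo_fun_increasing.
- rewrite ltNge => /negP[]; apply: (@le_trans _ _ (l + 1)%:~R).
    by rewrite intrD lerD2l ltW.
  by rewrite (@le_trans _ _ k%:~R) ?ler_int ?lezD1// lerDl unit_itv_ge0.
move=> _; apply: (@lt_le_trans _ _ (k + 1)%:~R).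
  by rewrite intrD ltrD2l homeo_lt1.
by rewrite (@le_trans _ _ l%:~R) ?ler_int ?lezD1// lerDl unit_itv_ge0.
Qed.

Lemma cellwiseK p : cancel (cellwise p) (cellwise (fun k => (p k)^-1)%g).
Proof.
move=> r; rewrite cellwise_comp -[RHS]cellwise1; congr cellwise.
by apply/funext => k; rewrite mulVg.
Qed.

Lemma cellwiseVK p : cancel (cellwise (fun k => (p k)^-1)%g) (cellwise p).
Proof.
move=> r; rewrite cellwise_comp -[RHS]cellwise1; congr cellwise.
by apply/funext => k; rewrite mulgV.
Qed.

Definition cell_homeo (p : int -> homeo R) : homeo R :=
  line_homeo (cellwiseK p) (cellwiseVK p) (cellwise_lt p).

(** * Translations and their interaction with cellwise maps *)

Lemma translation_lt (a : R) : {homo +%R^~ a : r s / r < s}.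
Proof. by move=> r s; rewrite ltrD2r. Qed.

Definition translation_homeo (a : R) : homeo R :=
  line_homeo (addrK a) (subrK a) (@translation_lt a).

Lemma translation_homeoD (a b : R) :
  translation_homeo (a + b) = (translation_homeo a * translation_homeo b)%g.
Proof.
apply: homeo_ext => x /=; rewrite extend_comp; congr extend.
by apply/funext => r /=; rewrite addrAC addrA.
Qed.

Lemma translation_homeo_inj : injective translation_homeo.
Proof.
(* A translation is determined by its value at 0. *)
move=> a b ab; rewrite -[a]add0r -[b]add0r.
by apply: (@extend_inj (+%R^~ a) (+%R^~ b)) => x; exact: (congr1 (@homeo_fun R ^~ x) ab).
Qed.

Lemma cell_homeo1 : cell_homeo (fun=> 1%g) = 1%g.
Proof.
apply: homeo_ext => x /=; apply: val_inj; rewrite -[val]set_valE val_extend.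
by case: ifP => // x01; rewrite cellwise1 logitK.
Qed.

Lemma cell_homeoM p q :
  cell_homeo (fun k => p k * q k)%g = (cell_homeo p * cell_homeo q)%g.
Proof.
apply: homeo_ext => x /=; rewrite extend_comp; congr extend.
by apply/funext => r /=; rewrite cellwise_comp.
Qed.

(** Products are compositions: on the left the translation acts first and carries cell [k] to cell
    [k + m], where [p (k + m)] awaits. *)
Lemma cell_homeo_translation p (m : int) :
  (cell_homeo p * translation_homeo m%:~R =
   translation_homeo m%:~R * cell_homeo (fun k => p (k + m)))%g.
Proof.
apply: homeo_ext => x /=; rewrite !extend_comp; congr extend.
apply/funext => r /=; have [k y y1 ->] := floor_fracP r.
by rewrite addrAC -intrD !cellwise_shift// intrD addrAC.
Qed.

Lemma cell_homeo_inj p q : cell_homeo p = cell_homeo q -> p =1 q.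
Proof.
move=> pq k; apply: homeo_ext => x.
have e : cellwise p =1 cellwise q.
  by apply: extend_inj => y; exact: (congr1 (@homeo_fun R ^~ y) pq).
(* The half-open cells do not test the point 1, but every [homeo] fixes it. *)
have [x1|x1] := ltP (set_val x) 1; last first.
  by rewrite !homeo_fix1//; apply: le_anti; rewrite x1 unit_itv_le1.
have := e (k%:~R + set_val x); rewrite !cellwise_shift// => /addrI.
exact: val_inj.
Qed.

(** * The alternating action of pairs of homeomorphisms *)

Definition alternating (fg : homeo R * homeo R) : homeo R :=
  cell_homeo (fun k => if odd `|k|%N then fg.2 else fg.1).

Lemma alternatingM : {morph alternating : u v / (u * v)%g}.
Proof.
move=> u v; rewrite /alternating -cell_homeoM; congr cell_homeo.
by apply/funext => k; case: odd.
Qed.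

Lemma alternating_inj : injective alternating.
Proof.
move=> [u1 u2] [v1 v2] /cell_homeo_inj uv.
(* Cell 0 recovers the first component and cell 1 the second. *)
by have := uv 0; have := uv 1 => /= -> ->.
Qed.

Lemma alternating_translation f g :
  (alternating (f, g) * translation_homeo 1 =
   translation_homeo 1 * alternating (g, f))%g.
Proof.
rewrite (cell_homeo_translation _ 1); congr (_ * cell_homeo _)%g.
apply/funext => k /=; have -> : odd `|(k + 1)%R|%N = ~~ odd `|k|%N by lia.
by case: odd.
Qed.

(** Moving the second translation leftwards swaps the components of the first alternating factor,
    which then cancels the other one. *)
Lemma skew_square f :
  ((translation_homeo 1 * alternating (f, f^-1)) ^+ 2 = translation_homeo 2)%g.
Proof.
have fV : alternating ((f^-1, f) * (f, f^-1))%g = 1%g.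
  have -> : ((f^-1, f) * (f, f^-1))%g = (1, 1)%g :> homeo R * homeo R.
    by congr pair; rewrite (mulVg, mulgV).
  by rewrite -[RHS]cell_homeo1; congr cell_homeo; apply/funext => k; case: odd.
rewrite expgS expg1 -mulgA [X in (_ * X)%g]mulgA (alternating_translation f f^-1%g).
rewrite -[X in (_ * X)%g]mulgA -(alternatingM (f^-1, f)%g (f, f^-1)%g) fV mulg1.
by rewrite -(translation_homeoD 1 1).
Qed.

(** With all letters equal, a word only counts through its exponent sum, written here as its value
    in the integers. *)
Lemma word_eval_translation {m : nat} (a : R) (w : word m) :
  word_eval (fun=> translation_homeo a) w = translation_homeo
    (a *~ word_eval (fun=> 1 : Algebra.to_multiplicative int) w).
Proof.
have t0 : translation_homeo 0 = 1%g.
  by apply: (@mulgI _ (translation_homeo 0)); rewrite -translation_homeoD addr0 mulg1.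
rewrite /word_eval; elim: w => [|[i b] w IH]; first by rewrite !big_nil t0.
rewrite !big_cons IH /= mulrzDr translation_homeoD; congr (_ * _)%g.
case: b => //; apply: (@mulgI _ (translation_homeo a)).
by rewrite mulgV -translation_homeoD mulrN1z subrr.
Qed.

End Homeos.

Theorem theorem1p12 (R : realType) (n : nat)
    (Z : groupType) (t : 'I_n.+1 -> Z)
    (Zpres : presented_by t (@equal_generators n.+1))
    (h : 'I_n -> homeo R) :
  exists G : set (homeo R),
    square_root t G /\
    exists A : set (homeo R),
      [/\ subgroup A, A `<=` G & isomorphic (skew_subdirect h) A].
Proof.
pose tau := @translation_homeo R 1%R.
(* The additional generator is sent to [tau] itself, so that [tau] can later be divided out of the
   others. *)
pose g i := if unlift ord0 i is Some j
  then (tau * alternating (h j, (h j)^-1))%g else tau.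
have g2 : (fun i => g i ^+ 2)%g = fun=> translation_homeo 2%R.
  apply/funext => i; rewrite /g; case: unliftP => [j|] _; first exact: skew_square.
  by rewrite expgS expg1 -translation_homeoD.
exists (gen (range g)); split.
  exists g => //; rewrite g2; apply: marked_isomorphic_words => u v.
  (* Both conditions become statements on exponent sums; since 2 is nonzero, distinct sums give
     distinct translations. *)
  rewrite Zpres.2 -(int_presented_by n).2 !word_eval_translation.
  split=> [-> //|/translation_homeo_inj].
  by apply: mulrIz; rewrite pnatr_eq0.
exists (@alternating R @` skew_subdirect h); split.
- exact: subgroup_image (@alternatingM R) (subgroup_gen _).
- have Gg i : g i \in gen (range g) by apply/mem_set; apply: sub_gen; exists i.
  have sG := subgroup_gen (range g).
  rewrite image_sub.
  apply: gen_subP; first exact: subgroup_preimage (@alternatingM R) sG.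
  move=> _ [j _ <-]; rewrite /preimage /=.
  (* Dividing by [tau] leaves exactly the image of a generator of the skew subdirect product. *)
  have -> : alternating (h j, (h j)^-1)%g = ((g ord0)^-1 * g (lift ord0 j))%g.
    by rewrite /g unlift_none liftK mulKg.
  by apply/set_mem; apply: (group_closedM sG) => //; exact: (group_closedV sG).
exists (@alternating R); split; last by move=> u v _ _; exact: alternatingM.
split=> [u ? | u v _ _ | _ [u ? <-]]; last by exists u.
  by exists u.
exact: alternating_inj.
Qed.
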